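(* Let $m$ be a positive integer, let $r\ge0$, and let $\lambda$ be a nonzero real number. Then for all integers $n,j\ge0$, $$W^{(r)}_{m,\lambda}(n,j)=\sum_{l=j}^n\binom{n}{l}(r)_{n-l,\lambda}\,m^{l-j}\,S_{2,\frac{\lambda}{m}}(l,j).$$
   Context: For real $x$ and nonzero real $\mu$, $(x)_{0,\mu}=1$, $(x)_{n,\mu}=x(x-\mu)\cdots(x-(n-1)\mu)$ for $n\ge1$; $(x)_0=1$, $(x)_k=x(x-1)\cdots(x-k+1)$. The degenerate Stirling numbers of the second kind $S_{2,\mu}(n,k)$ are defined by $(x)_{n,\mu}=\sum_{k=0}^nS_{2,\mu}(n,k)(x)_k$ (and are $0$ for $k>n$). The degenerate $r$-Whitney numbers of the second kind $W^{(r)}_{m,\lambda}(n,k)$ are defined by the polynomial identity $(mx+r)_{n,\lambda}=\sum_{k=0}^nW^{(r)}_{m,\lambda}(n,k)m^k(x)_k$ (and are $0$ for $k>n$). *)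

(* Defs.v *)
From mathcomp Require Import all_boot all_order all_algebra.
From mathcomp Require Import ring.
From mathcomp Require Import boolp reals.

Set Implicit Arguments.
Unset Strict Implicit.
Unset Printing Implicit Defensive.

Import Order.TTheory GRing.Theory Num.Theory.
Local Open Scope ring_scope.

Definition degenerate_ffact (R : realType) (mu x : R) (n : nat) : R :=
  \prod_(i < n) (x - i%:R * mu).

(* Unlike the nat-valued [^_] of binomial, the base here is real. *)
Definition real_ffact (R : realType) (x : R) (k : nat) : R :=
  \prod_(i < k) (x - i%:R).

Definition is_degenerate_stirling2 (R : realType) (mu : R)
    (S : nat -> nat -> R) : Prop :=
  (forall (n : nat) (x : R),
     degenerate_ffact mu x n = \sum_(0 <= k < n.+1) S n k * real_ffact x k) /\
  (forall n k : nat, (n < k)%N -> S n k = 0).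

Definition is_degenerate_whitney2 (R : realType) (m : nat) (r lambda : R)
    (W : nat -> nat -> R) : Prop :=
  (forall (n : nat) (x : R),
     degenerate_ffact lambda (m%:R * x + r) n =
       \sum_(0 <= k < n.+1) W n k * m%:R ^+ k * real_ffact x k) /\
  (forall n k : nat, (n < k)%N -> W n k = 0).

Lemma is_degenerate_whitney2_ex (R : realType) (m : nat) (r lambda : R) :
  exists W, is_degenerate_whitney2 m r lambda W.
Proof.
pose W := fix W (n k : nat) {struct n} : R :=
  if n is n'.+1 then
    (if k is k'.+1 then W n' k' else 0) +
    (r + m%:R * k%:R - n'%:R * lambda) * W n' k
  else (k == 0%N)%:R.
have W0 n k : (n < k)%N -> W n k = 0.
  elim: n k => [|n IH] [|k] //= ltnk.
  by rewrite !IH ?mulr0 ?addr0 // ltnW.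
exists W; split=> // n x.
elim: n => [|n IH].
  by rewrite big_nat1 /degenerate_ffact /real_ffact !big_ord0 /= !mul1r.
rewrite /degenerate_ffact big_ord_recr /= -/(degenerate_ffact _ _ n) IH.
have -> : \sum_(0 <= k < n.+2) W n.+1 k * m%:R ^+ k * real_ffact x k =
    \sum_(0 <= k < n.+1) W n k * m%:R ^+ k.+1 * real_ffact x k.+1 +
    \sum_(0 <= k < n.+1) (r + m%:R * k%:R - n%:R * lambda) * W n k
                           * m%:R ^+ k * real_ffact x k.
  rewrite (eq_bigr (fun k => (if k is k'.+1 then W n k' else 0) * m%:R ^+ k
      * real_ffact x k + (r + m%:R * k%:R - n%:R * lambda) * W n k
                           * m%:R ^+ k * real_ffact x k)); last first.
    by move=> k _; rewrite -!mulrDl.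
  rewrite big_split /=; congr (_ + _).
    by rewrite big_nat_recl // !mul0r add0r.
  by rewrite big_nat_recr //= W0 // mulr0 !mul0r addr0.
rewrite -big_split /= mulr_suml; apply: eq_bigr => k _.
by rewrite /real_ffact big_ord_recr /= exprS; ring.
Qed.

Lemma is_degenerate_stirling2_ex (R : realType) (mu : R) :
  exists S, is_degenerate_stirling2 mu S.
Proof.
have [S [eqS S0]] := is_degenerate_whitney2_ex 1 0 mu.
exists S; split=> // n x; have := eqS n x; rewrite mul1r addr0 => ->.
by apply: eq_bigr => k _; rewrite expr1n mulr1.
Qed.

Lemma real_ffact_free (R : realType) (n : nat) (c : nat -> R) :
  (forall x : R, \sum_(0 <= k < n) c k * real_ffact x k = 0) ->
  forall k, (k < n)%N -> c k = 0.
Proof.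
move=> c0; elim/ltn_ind => j IH ltjn.
have := c0 j%:R; rewrite (bigD1_seq j) ?mem_index_iota ?iota_uniq //=.
rewrite big1_seq ?addr0; last first.
  move=> k /andP[neqkj]; rewrite mem_index_iota => /andP[_ ltkn].
  move: neqkj; rewrite neq_ltn => /orP[ltkj|ltjk]; first by rewrite IH ?mul0r.
  by rewrite /real_ffact (bigD1 (Ordinal ltjk)) //= subrr mul0r mulr0.
move=> /eqP; rewrite mulf_eq0 => /orP[/eqP //|].
rewrite prodf_seq_eq0 => /hasP[i _] /=.
by rewrite subr_eq0 eqr_nat (gtn_eqF (ltn_ord i)).
Qed.

Lemma is_degenerate_whitney2_uniq (R : realType) (m : nat) (r lambda : R) W W' :
  (0 < m)%N -> is_degenerate_whitney2 m r lambda W ->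
  is_degenerate_whitney2 m r lambda W' -> forall n k, W n k = W' n k.
Proof.
move=> m_gt0 [eqW W0] [eqW' W'0] n k.
have [lekn|ltnk] := leqP k n; last by rewrite W0 ?W'0.
have mk_neq0 : m%:R ^+ k != 0 :> R by rewrite expf_neq0 // pnatr_eq0 -lt0n.
apply/eqP; rewrite -subr_eq0 -(mulIr_eq0 _ (mulIf mk_neq0)); apply/eqP.
apply: (@real_ffact_free _ n.+1 (fun k => (W n k - W' n k) * m%:R ^+ k)) => // x.
under eq_bigr do rewrite !mulrBl.
by rewrite sumrB -eqW -eqW' subrr.
Qed.

Lemma is_degenerate_stirling2_uniq (R : realType) (mu : R) S S' :
  is_degenerate_stirling2 mu S -> is_degenerate_stirling2 mu S' ->
  forall n k, S n k = S' n k.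
Proof.
move=> [eqS S0] [eqS' S'0] n k.
apply: (@is_degenerate_whitney2_uniq _ 1 0 mu) => //; split=> // {}n x.
  by rewrite mul1r addr0 eqS; apply: eq_bigr => i _; rewrite expr1n mulr1.
by rewrite mul1r addr0 eqS'; apply: eq_bigr => i _; rewrite expr1n mulr1.
Qed.

Definition degenerate_stirling2 (R : realType) (mu : R) : nat -> nat -> R :=
  sval (cid (is_degenerate_stirling2_ex mu)).

Lemma degenerate_stirling2P (R : realType) (mu : R) :
  is_degenerate_stirling2 mu (degenerate_stirling2 mu).
Proof. exact: (svalP (cid (is_degenerate_stirling2_ex mu))). Qed.

(* For $m = 0$ the defining identity does not determine the array uniquely,
   and the value is then an unspecified solution. *)
Definition degenerate_whitney2 (R : realType) (m : nat) (r lambda : R) :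
    nat -> nat -> R :=
  sval (cid (is_degenerate_whitney2_ex m r lambda)).

Lemma degenerate_whitney2P (R : realType) (m : nat) (r lambda : R) :
  is_degenerate_whitney2 m r lambda (degenerate_whitney2 m r lambda).
Proof. exact: (svalP (cid (is_degenerate_whitney2_ex m r lambda))). Qed.

(* Main.v *)
(* By the Vandermonde identity for degenerate falling factorials and the scaling
   rule (m x)_{l,lambda} = m^l (x)_{l,lambda/m}, the right-hand side satisfies
   the identity which determines the degenerate r-Whitney numbers. *)
Require Import Defs.
From mathcomp Require Import all_boot all_order all_algebra.
From mathcomp Require Import ring.
From mathcomp Require Import boolp reals.
Import Order.TTheory GRing.Theory Num.Theory.
Local Open Scope ring_scope.

Lemma degenerate_ffactS (R : realType) (mu x : R) (n : nat) :
  degenerate_ffact mu x n.+1 = degenerate_ffact mu x n * (x - n%:R * mu).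
Proof. by rewrite /degenerate_ffact big_ord_recr. Qed.

(** Induction on [n], as for the binomial theorem: the new factor is shared between the two
    factorials and Pascal's rule recombines the coefficients. *)
Lemma degenerate_ffactD (R : realType) (mu x y : R) (n : nat) :
  degenerate_ffact mu (x + y) n =
    \sum_(0 <= l < n.+1)
      'C(n, l)%:R * degenerate_ffact mu x l * degenerate_ffact mu y (n - l).
Proof.
elim: n => [|n IH].
  by rewrite big_nat1 /degenerate_ffact !big_ord0 !mul1r.
rewrite degenerate_ffactS IH mulr_suml.
pose T l : R :=
  'C(n, l)%:R * degenerate_ffact mu x l * degenerate_ffact mu y (n.+1 - l).
pose U l : R :=
  'C(n, l)%:R * degenerate_ffact mu x l.+1 * degenerate_ffact mu y (n - l).
(* Write [x + y - n * mu] as [(y - (n - l) * mu) + (x - l * mu)]: the first summand lengthens the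
   factorial of [y], giving [T l], the second that of [x], giving [U l]. *)
transitivity (\sum_(0 <= l < n.+1) (T l + U l)).
  apply: eq_big_nat => l /andP[_]; rewrite ltnS => le_ln.
  by rewrite /T /U subSn // !degenerate_ffactS natrB //; ring.
rewrite big_split /= [RHS]big_nat_recl // bin0.
under [X in _ = _ + X]eq_bigr do rewrite binS natrD !mulrDl subSS.
rewrite big_split /= addrA; congr (_ + _).
(* The added term is zero because ['C(n, n.+1) = 0]; splitting off [l = 0] then gives the indices
   [l.+1] that Pascal's rule produces. *)
have -> : \sum_(0 <= l < n.+1) T l = \sum_(0 <= l < n.+2) T l.
  by rewrite [RHS]big_nat_recr //= {3}/T bin_small // !mul0r addr0.
by rewrite [LHS]big_nat_recl // /T bin0.
Qed.

Lemma degenerate_ffactM (R : realType) (c mu x : R) (n : nat) :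
  c != 0 -> degenerate_ffact mu (c * x) n = c ^+ n * degenerate_ffact (mu / c) x n.
Proof.
move=> c_neq0; elim: n => [|n IH].
  by rewrite /degenerate_ffact !big_ord0 mulr1.
by rewrite !degenerate_ffactS IH exprS; field.
Qed.

Lemma is_degenerate_whitney2_stirling2 (R : realType) (m : nat) (r lambda : R)
    (S : nat -> nat -> R) :
  (0 < m)%N -> is_degenerate_stirling2 (lambda / m%:R) S ->
  is_degenerate_whitney2 m r lambda (fun n j => \sum_(j <= l < n.+1)
    'C(n, l)%:R * degenerate_ffact lambda r (n - l) * m%:R ^+ (l - j) * S l j).
Proof.
move=> m_gt0 [eqS S0]; split=> [n x|n j lt_nj]; last by rewrite big_geq.
have m_neq0 : m%:R != 0 :> R by rewrite pnatr_eq0 -lt0n.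
(* The power [m ^ l] comes from the scaling rule; in the target it arises as
   [m ^ (l - k) * m ^ k]. *)
pose F l k := 'C(n, l)%:R * degenerate_ffact lambda r (n - l) * m%:R ^+ l
  * S l k * real_ffact x k.
transitivity (\sum_(0 <= l < n.+1) \sum_(0 <= k < n.+1) F l k).
  rewrite degenerate_ffactD; apply: eq_big_nat => l /andP[_ lt_ln].
  (* Since [S l k = 0] for [l < k], the triangle [k <= l] can be padded to a square, where the sums
     exchange freely. *)
  rewrite degenerate_ffactM // eqS [RHS](big_cat_nat (n := l.+1)) //=.
  rewrite [X in _ + X]big_nat_cond [X in _ + X]big1 ?addr0; last first.
    by move=> k /andP[/andP[lt_lk _] _]; rewrite /F S0 // mulr0 mul0r.
  rewrite mulr_sumr mulr_sumr mulr_suml.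
  by apply: eq_bigr => k _; rewrite /F; ring.
rewrite exchange_big /=; apply: eq_big_nat => k /andP[_ lt_kn].
(* The same vanishing now discards [l < k], so the truncated [l - k] is a true difference. *)
rewrite (big_cat_nat (n := k)) ?(ltnW lt_kn) //=.
rewrite [X in X + _]big_nat_cond [X in X + _]big1 ?add0r; last first.
  by move=> l /andP[/andP[_ lt_lk] _]; rewrite /F S0 // mulr0 mul0r.
rewrite !mulr_suml; apply: eq_big_nat => l /andP[le_kl _].
by rewrite /F -[in _ ^+ l](subnK le_kl) exprD; ring.
Qed.

Theorem theorem8 (R : realType) (m : nat) (r lambda : R)
    (m_gt0 : (0 < m)%N) (r_ge0 : 0 <= r) (lambda_neq0 : lambda != 0)
    (n j : nat) :
  degenerate_whitney2 m r lambda n j =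
    \sum_(j <= l < n.+1)
      'C(n, l)%:R * degenerate_ffact lambda r (n - l) * m%:R ^+ (l - j)
      * degenerate_stirling2 (lambda / m%:R) l j.
Proof.
have := is_degenerate_whitney2_stirling2 _ _ r _ _ m_gt0
  (degenerate_stirling2P (lambda / m%:R)).
by move=> /(is_degenerate_whitney2_uniq m_gt0 (degenerate_whitney2P m r lambda)) ->.
Qed.
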